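(* Let $\mathfrak{R}(t)\in\mathcal{M}_{l,m}$ be a solution of $\dot{\mathfrak{R}}=\mathcal{L}(t,\mathfrak{R})$ such that $\sigma_r(\mathfrak{R}(t))>\sigma_{r+1}(\mathfrak{R}(t))$. Let the (time-dependent) singular value decomposition of $\mathfrak{R}(t)$ at time $t$ be $\sum_{i=1}^{r+k}\sigma_iu_iv_i^T$ with $\sigma_1\ge\dots\ge\sigma_{r+k}$ and $r+k=\min(l,m)$ (allowing possibly $\sigma_{r+j}=0$ for $1\le j\le k$). Then the modes $U(t)\in\mathcal{M}_{l,r}$ and coefficients $Z(t)\in\mathcal{M}_{m,r}$ of the best rank-$r$ approximation $\Pi_{\mathscr{M}}(\mathfrak{R}(t))=U(t)Z(t)^T$, with $U^TU=I$ and $U^T\dot U=0$, evolve according to the system of ODEs $$\left\{\begin{aligned}\dot U&=(I-UU^T)\dot{\mathfrak{R}}Z(Z^TZ)^{-1}\\&\quad+\left[\sum_{\substack{1\le i\le r\\1\le j\le k}}\frac{\sigma_{r+j}}{\sigma_i^2-\sigma_{r+j}^2}(\sigma_iu_{r+j}^T\dot{\mathfrak{R}}v_i+\sigma_{r+j}u_i^T\dot{\mathfrak{R}}v_{r+j})u_{r+j}v_i^T\right]Z(Z^TZ)^{-1},\\\dot Z&=\dot{\mathfrak{R}}^TU+\left[\sum_{\substack{1\le i\le r\\1\le j\le k}}\frac{\sigma_{r+j}}{\sigma_i^2-\sigma_{r+j}^2}(\sigma_{r+j}u_{r+j}^T\dot{\mathfrak{R}}v_i+\sigma_iu_i^T\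dot{\mathfrak{R}}v_{r+j})v_{r+j}u_i^T\right]U.\end{aligned}\right.$$
   Context: $\mathcal{M}_{l,m}$ is the space of $l\times m$ real matrices with the Frobenius norm, and $\mathcal{L}$ is a time-dependent operator acting on $\mathcal{M}_{l,m}$. $\mathscr{M}=\{R\in\mathcal{M}_{l,m} : \mathrm{rank}(R)=r\}$. $\sigma_1(A)\ge\sigma_2(A)\ge\dots$ are the singular values of $A$ (zero beyond the rank). When $\sigma_r(\mathfrak{R})>\sigma_{r+1}(\mathfrak{R})$, $\Pi_{\mathscr{M}}(\mathfrak{R})$ is the unique matrix of $\mathscr{M}$ closest to $\mathfrak{R}$ in Frobenius norm, i.e. the rank $r$ truncated SVD of $\mathfrak{R}$. The dot denotes the time derivative. The condition $U^T\dot U=0$ is the ''dynamically orthogonal'' gauge condition, which fixes the factorization $UZ^T$ along the curve.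
   Formalization: The scalar factors in parentheses in the two correction sums are interchanged between the equations for U and Z: as printed the system fails, e.g. for R(t) = rotation(t)·diag(2,1) with r = 1. *)

(* Defs.v *)
From HB Require Import structures.
From mathcomp Require Import all_boot all_order all_algebra.
From mathcomp Require Import all_classical all_reals all_analysis.

Set Implicit Arguments.
Unset Strict Implicit.
Unset Printing Implicit Defensive.

Import Order.TTheory GRing.Theory Num.Theory.
Import numFieldNormedType.Exports.

Local Open Scope classical_set_scope.
Local Open Scope ring_scope.

(* The norm instance of 'M[R]_(l, m) in MathComp-Analysis is the entrywise
   sup norm.  The choice of norm is irrelevant for time derivatives, but not
   for best approximation, hence this separate norm. *)
Definition frobenius_norm (R : realType) (l m : nat) (A : 'M[R]_(l, m)) : R :=
  Num.sqrt (\sum_(i < l) \sum_(j < m) A i j ^+ 2).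

Definition fixed_rank (R : realType) (l m r : nat) : set 'M[R]_(l, m) :=
  [set A | \rank A = r].

(* The default value 0 is used only if A has no closest point in the set of
   rank r matrices (e.g. if r > minn l m).  If the closest point is not unique,
   some closest point is picked. *)
Definition rank_proj (R : realType) (l m r : nat) (A : 'M[R]_(l, m)) :
    'M[R]_(l, m) :=
  xget 0 [set B | fixed_rank r B /\
    forall C : 'M[R]_(l, m), fixed_rank r C ->
      frobenius_norm (A - B) <= frobenius_norm (A - C)].

Definition orthonormal_family (R : realType) (n p : nat)
    (u : 'I_p -> 'cV[R]_n) : Prop :=
  forall i j : 'I_p, (u i)^T *m u j = (i == j)%:R%:M.

Definition is_svd (R : realType) (l m p : nat) (A : 'M[R]_(l, m))
    (s : 'I_p -> R) (u : 'I_p -> 'cV[R]_l) (v : 'I_p -> 'cV[R]_m) : Prop :=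
  [/\ orthonormal_family u,
      orthonormal_family v,
      forall i : 'I_p, 0 <= s i,
      forall i j : 'I_p, (i <= j)%N -> s j <= s i &
      A = \sum_(i < p) s i *: (u i *m (v i)^T)].

(* sigma_n with the 1-based numbering of singular values, and sigma_n = 0
   for n > p; meaningful for n >= 1 only. *)
Definition singular_value (R : realType) (p : nat) (s : 'I_p -> R) (n : nat) :
    R :=
  oapp s 0 (insub n.-1).

(* The scalar u^T A v.

   For a = u_{r+j}^T dX v_i, b = u_i^T dX v_{r+j}, the (r+j, i) entry of the
   derivative of the projector U U^T is (sigma_i a + sigma_{r+j} b) / Delta,
   with Delta = sigma_i^2 - sigma_{r+j}^2.  Hence the correction to dU/dt has
   coefficient sigma_{r+j} (sigma_{r+j} a + sigma_i b) / Delta and the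
   correction to dZ/dt has sigma_{r+j} (sigma_i a + sigma_{r+j} b) / Delta.
   The source text has these two coefficients interchanged, which fails for
   X(t) = rotation(t) *m diag(2, 1), r = 1, U = (cos t, sin t)^T,
   Z = (2, 0)^T. *)
Definition bilin (R : realType) (l m : nat) (u : 'cV[R]_l) (A : 'M[R]_(l, m))
    (v : 'cV[R]_m) : R :=
  (u^T *m A *m v) 0 0.

(* Main.v *)
Require Import Defs.
From HB Require Import structures.
From mathcomp Require Import all_boot all_order all_algebra.
From mathcomp Require Import all_classical all_reals all_analysis.
From mathcomp Require Import ring lra.

Set Implicit Arguments.
Unset Strict Implicit.
Unset Printing Implicit Defensive.

Import Order.TTheory GRing.Theory Num.Theory.
Import numFieldNormedType.Exports.

Local Open Scope classical_set_scope.
Local Open Scope ring_scope.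

(** Write X = U1 S1 V1^T + U2 S2 V2^T, split after the first r singular
    triples.  The uniqueness part of Eckart-Young forces U U^T = U1 U1^T and
    U Z^T = U U^T X, that is Z = X^T U, so Z is differentiable along with U.
    Differentiating X Z = U (Z^T Z) and projecting with I - U U^T eliminates
    the derivative of Z^T Z and gives
      U' Z^T Z = (I - U U^T) X' Z + U2 S2 V2^T Z',  Z' = X'^T U + X^T U'.
    By the gauge condition X^T U' = V2 S2 (U2^T U'), and multiplying by U2^T
    turns the first equation into a Sylvester equation with diagonal
    coefficients S1^2 and S2^2 for U2^T U' U^T U1, solvable by the gap.  No
    regularity in time of the singular vectors is used. *)

(** * Squared Frobenius norm and Pythagorean identities *)

Definition sqnorm (R : realType) (m n : nat) (A : 'M[R]_(m, n)) : R :=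
  \tr (A^T *m A).

Lemma gram_diagE (R : realType) m n (A : 'M[R]_(m, n)) j :
  (A^T *m A) j j = \sum_i A i j ^+ 2.
Proof. by rewrite mxE; apply: eq_bigr => i _; rewrite mxE expr2. Qed.

Lemma gram_diag_ge0 (R : realType) m n (A : 'M[R]_(m, n)) j :
  0 <= (A^T *m A) j j.
Proof. by rewrite gram_diagE; apply: sumr_ge0 => i _; exact: sqr_ge0. Qed.

Lemma sqnorm_ge0 (R : realType) m n (A : 'M[R]_(m, n)) : 0 <= sqnorm A.
Proof. by apply: sumr_ge0 => i _; exact: gram_diag_ge0. Qed.

Lemma sqnorm_eq0 (R : realType) m n (A : 'M[R]_(m, n)) :
  sqnorm A = 0 -> A = 0.
Proof.
move=> A0; apply/matrixP => i j; rewrite mxE.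
have /eqP : (A^T *m A) j j = 0.
  by apply: (psumr_eq0P _ A0) => // k _; exact: gram_diag_ge0.
rewrite gram_diagE => /eqP Aj0; apply/eqP; rewrite -sqrf_eq0; apply/eqP.
by apply: (psumr_eq0P _ Aj0) => // k _; exact: sqr_ge0.
Qed.

Lemma frobenius_normE (R : realType) m n (A : 'M[R]_(m, n)) :
  frobenius_norm A = Num.sqrt (sqnorm A).
Proof.
rewrite /frobenius_norm exchange_big /=; congr Num.sqrt.
by apply: eq_bigr => j _; rewrite gram_diagE.
Qed.

Lemma frobenius_norm_le (R : realType) m n (A B : 'M[R]_(m, n)) :
  (frobenius_norm A <= frobenius_norm B) = (sqnorm A <= sqnorm B).
Proof. by rewrite !frobenius_normE ler_sqrt ?sqnorm_ge0. Qed.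

Lemma trmx_mul0 (R : realType) m n p (A : 'M[R]_(m, n)) (B : 'M[R]_(m, p)) :
  A^T *m B = 0 -> B^T *m A = 0.
Proof. by move=> AB0; rewrite -[LHS]trmxK trmx_mul trmxK AB0 trmx0. Qed.

(** Cross terms vanish because the column spaces are orthogonal; [sqnormDr] is the counterpart for
    orthogonal row spaces. *)
Lemma sqnormD (R : realType) m n (A B : 'M[R]_(m, n)) :
  A^T *m B = 0 -> sqnorm (A + B) = sqnorm A + sqnorm B.
Proof.
move=> AB0; have BA0 := trmx_mul0 AB0.
by rewrite /sqnorm [(A + B)^T]linearD /= mulmxDl !mulmxDr AB0 BA0 addr0 add0r mxtraceD.
Qed.

Lemma sqnorm_tr (R : realType) m n (A : 'M[R]_(m, n)) : sqnorm A^T = sqnorm A.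
Proof. by rewrite /sqnorm trmxK mxtrace_mulC. Qed.

Lemma sqnormDr (R : realType) m n (A B : 'M[R]_(m, n)) :
  A *m B^T = 0 -> sqnorm (A + B) = sqnorm A + sqnorm B.
Proof.
move=> AB0; rewrite -sqnorm_tr linearD /= sqnormD ?sqnorm_tr //.
by rewrite trmxK.
Qed.

Lemma sqnorm_mul_isometry (R : realType) m n p (A : 'M[R]_(m, n))
    (V : 'M[R]_(p, n)) : V^T *m V = 1%:M -> sqnorm (A *m V^T) = sqnorm A.
Proof.
move=> VV; rewrite -sqnorm_tr -[in RHS]sqnorm_tr /sqnorm !trmxK trmx_mul trmxK.
by rewrite -mulmxA [V^T *m _]mulmxA VV mul1mx.
Qed.

Lemma sqnorm_diag (R : realType) m n (A : 'M[R]_(m, n)) (d : 'rV[R]_n) :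
  sqnorm (A *m diag_mx d) = \sum_j d 0 j ^+ 2 * (A^T *m A) j j.
Proof.
apply: eq_bigr => j _; rewrite !gram_diagE mulr_sumr; apply: eq_bigr => i _.
by rewrite mul_mx_diag mxE exprMn mulrC.
Qed.

(* The constant c in svd_gap is sigma_{r+1}, read as 0 when k = 0. *)
Record split_svd (R : realType) (l m r k : nat) (A : 'M[R]_(l, m))
    (U1 : 'M[R]_(l, r)) (U2 : 'M[R]_(l, k)) (V1 : 'M[R]_(m, r))
    (V2 : 'M[R]_(m, k)) (d1 : 'rV[R]_r) (d2 : 'rV[R]_k) : Prop := SplitSvd {
  svd_U11 : U1^T *m U1 = 1%:M;
  svd_U22 : U2^T *m U2 = 1%:M;
  svd_U12 : U1^T *m U2 = 0;
  svd_V11 : V1^T *m V1 = 1%:M;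
  svd_V22 : V2^T *m V2 = 1%:M;
  svd_V12 : V1^T *m V2 = 0;
  svd_eq : A = U1 *m diag_mx d1 *m V1^T + U2 *m diag_mx d2 *m V2^T;
  svd_gap : exists c : R, [/\ 0 <= c, forall i, c < d1 0 i &
                          forall j, 0 <= d2 0 j <= c] }.

(** * Eckart-Young inequality and its equality case *)

Lemma sqnorm_proj_compl (R : realType) l n (P : 'M[R]_l) (B : 'M[R]_(l, n)) :
  P^T = P -> P *m P = P ->
  sqnorm B = sqnorm (P *m B) + sqnorm ((1%:M - P) *m B).
Proof.
move=> PT PP; rewrite -[in LHS](subrKC (P *m B) B) -{2}[B]mul1mx -mulmxBl.
by rewrite sqnormD // trmx_mul PT -mulmxA (mulmxA P) mulmxBr mulmx1 PP subrr
  mul0mx mulmx0.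
Qed.

(** Cutting the rows of P along the ranges of U1, U2 and their common complement gives three
    orthogonal pieces, and tr P is the squared norm of P. When tr P = r, the weight that P puts on
    U2 is at most the weight that it misses on U1. *)
Lemma svd_bessel (R : realType) l m r k (A : 'M[R]_(l, m)) U1 U2
    (V1 : 'M[R]_(m, r)) (V2 : 'M[R]_(m, k)) d1 d2 (P : 'M[R]_l) :
  split_svd A U1 U2 V1 V2 d1 d2 -> P^T = P -> P *m P = P ->
  sqnorm (P *m U1) + sqnorm (P *m U2) <= \tr P.
Proof.
move=> [U11 U22 U12 _ _ _ _ _] PT PP; have U21 := trmx_mul0 U12.
have -> : \tr P = sqnorm P by rewrite /sqnorm PT PP.
pose N := 1%:M - U1 *m U1^T - U2 *m U2^T.
have PE : P = P *m U1 *m U1^T + P *m U2 *m U2^T + P *m N.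
  by rewrite /N !mulmxBr mulmx1 !mulmxA -[X in _ = _ + X]addrA -opprD subrKC.
have NT : N^T = N by rewrite /N !linearB /= !trmx_mul !trmxK trmx1.
have NU1 : U1^T *m N = 0.
  by rewrite /N !mulmxBr mulmx1 !mulmxA U11 U12 mul0mx mul1mx subr0 subrr.
have NU2 : U2^T *m N = 0.
  by rewrite /N !mulmxBr mulmx1 !mulmxA U22 U21 mul0mx mul1mx subr0 subrr.
rewrite [in leRHS]PE sqnormDr; last first.
  by rewrite trmx_mul NT mulmxDl -!(mulmxA (P *m _)) !(mulmxA _ N) NU1 NU2
    !(mul0mx, mulmx0) addr0.
rewrite sqnormDr; last first.
  by rewrite trmx_mul trmxK -(mulmxA (P *m U1)) (mulmxA _ U2) U12 mul0mx mulmx0.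
by rewrite !sqnorm_mul_isometry // lerDl sqnorm_ge0.
Qed.

(* Eckart-Young for a single competitor C, whose column space lies in the
   range of the rank r orthogonal projector P.  The error exceeds the optimum by
   at least sum_i (d1_i^2 - c^2) |(1 - P) u_i|^2 + |P A - C|^2. *)
Lemma svd_proj_approx (R : realType) l m r k (A C : 'M[R]_(l, m)) U1 U2
    (V1 : 'M[R]_(m, r)) (V2 : 'M[R]_(m, k)) d1 d2 (P : 'M[R]_l) :
  split_svd A U1 U2 V1 V2 d1 d2 ->
  P^T = P -> P *m P = P -> \tr P = r%:R -> P *m C = C ->
  sqnorm (U2 *m diag_mx d2 *m V2^T) <= sqnorm (A - C) /\
  (sqnorm (A - C) <= sqnorm (U2 *m diag_mx d2 *m V2^T) ->
   P = U1 *m U1^T /\ C = P *m A).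
Proof.
move=> svdA PT PP trP PC.
have bessel := svd_bessel svdA PT PP.
case: (svdA) => U11 U22 U12 V11 V22 V12 Aeq [c [c0 cd1 cd2]].
(* A - C splits into (1 - P) A, orthogonal to the range of P, and P A - C, inside it. *)
have eAC : sqnorm (A - C) = sqnorm ((1%:M - P) *m A) + sqnorm (P *m A - C).
  have -> : A - C = (1%:M - P) *m A + (P *m A - C).
    by rewrite mulmxBl mul1mx addrA subrK.
  rewrite sqnormD // trmx_mul [(1%:M - P)^T]linearB /= trmx1 PT.
  have -> : P *m A - C = P *m (A - C) by rewrite mulmxBr PC.
  by rewrite -mulmxA (mulmxA _ P) mulmxBl mul1mx PP subrr mul0mx mulmx0.
set B1 := (1%:M - P) *m U1.
have eA : sqnorm ((1%:M - P) *m A) =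
    sqnorm (B1 *m diag_mx d1) + sqnorm ((1%:M - P) *m (U2 *m diag_mx d2)).
  rewrite Aeq mulmxDr sqnormDr.
    by rewrite !(mulmxA _ _ V1^T) !(mulmxA _ _ V2^T) !sqnorm_mul_isometry // mulmxA.
  by rewrite !trmx_mul trmxK -!mulmxA (mulmxA V1^T) V12 mul0mx !mulmx0.
have eA2 := sqnorm_proj_compl (U2 *m diag_mx d2) PT PP.
have eU1 := sqnorm_proj_compl U1 PT PP.
have U1r : sqnorm U1 = r%:R by rewrite /sqnorm U11 mxtrace1.
rewrite -/B1 U1r in eU1.
rewrite (sqnorm_mul_isometry _ V22) eAC eA eA2.
have le2 : sqnorm (P *m (U2 *m diag_mx d2)) <= c ^+ 2 * sqnorm (P *m U2).
  rewrite mulmxA sqnorm_diag mulr_sumr; apply: ler_sum => j _.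
  rewrite ler_wpM2r ?gram_diag_ge0 // lerXn2r ?nnegrE //; by case/andP: (cd2 j).
(* Bessel with tr P = r = |U1|^2 gives |P U2|^2 <= |B1|^2. *)
have le1 : c ^+ 2 * sqnorm (P *m U2) <= c ^+ 2 * sqnorm B1.
  by rewrite ler_wpM2l ?sqr_ge0 //; lra.
have eB1 : sqnorm (B1 *m diag_mx d1) = c ^+ 2 * sqnorm B1 +
    \sum_i (d1 0 i ^+ 2 - c ^+ 2) * (B1^T *m B1) i i.
  rewrite sqnorm_diag mulr_sumr -big_split; apply: eq_bigr => i _ /=; ring.
have c2 i : 0 < d1 0 i ^+ 2 - c ^+ 2.
  by rewrite subr_gt0 ltrXn2r ?nnegrE ?cd1 // (le_trans c0) // ltW.
have term0 i : 0 <= (d1 0 i ^+ 2 - c ^+ 2) * (B1^T *m B1) i i.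
  by rewrite mulr_ge0 ?gram_diag_ge0 // ltW.
have sum0 : 0 <= \sum_i (d1 0 i ^+ 2 - c ^+ 2) * (B1^T *m B1) i i.
  exact: sumr_ge0.
have PAC0 := sqnorm_ge0 (P *m A - C).
(* The term of (1 - P) U2 D2 occurs on both sides and cancels; what remains is |P U2 D2|^2 <= c^2 |P
   U2|^2 <= c^2 |B1|^2 <= |B1 D1|^2. Equality forces both nonnegative surplus terms to vanish. *)
split=> [|le]; first by lra.
have s0 : \sum_i (d1 0 i ^+ 2 - c ^+ 2) * (B1^T *m B1) i i = 0.
  by apply/eqP; rewrite eq_le sum0 andbT; lra.
have PAC : P *m A - C = 0 by apply: sqnorm_eq0; lra.
have B10 : B1 = 0.
  apply: sqnorm_eq0; rewrite /sqnorm /mxtrace big1 // => i _.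
  have /eqP : (d1 0 i ^+ 2 - c ^+ 2) * (B1^T *m B1) i i = 0.
    by apply: (psumr_eq0P _ s0).
  by rewrite mulf_eq0 gt_eqF //= => /eqP.
split; last by apply/eqP; rewrite eq_sym -subr_eq0 PAC.
have PU1 : P *m U1 = U1.
  by apply/eqP; rewrite eq_sym -subr_eq0 -{1}[U1]mul1mx -mulmxBl -/B1 B10.
(* Since P U1 = U1, the squared norm of P - U1 U1^T is tr P - tr (U1 U1^T) = r - r. *)
apply/eqP; rewrite -subr_eq0; apply/eqP/sqnorm_eq0.
rewrite /sqnorm [(P - _)^T]linearB /= trmx_mul trmxK PT mulmxBl !mulmxBr PP.
rewrite mulmxA PU1 -[X in _ - (X - _)]mulmxA.
rewrite -[U1^T *m P](trmxK) trmx_mul trmxK PT PU1.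
rewrite -!mulmxA [U1^T *m (U1 *m _)]mulmxA U11 mul1mx subrr subr0.
by rewrite linearB /= trP mxtrace_mulC U11 mxtrace1 subrr.
Qed.

(** With C = F H a full rank factorization, P = F (F^T F)^-1 F^T; cyclicity turns its trace into
    that of an identity matrix of size rank C. *)
Lemma orthogonal_proj_exists (R : realType) (l m : nat) (C : 'M[R]_(l, m)) :
  exists P : 'M[R]_l,
    [/\ P^T = P, P *m P = P, \tr P = (\rank C)%:R & P *m C = C].
Proof.
have FT : row_free (col_base C)^T.
  by rewrite /row_free mxrank_tr -/(row_full (col_base C)) col_base_full.
(* generalized to keep rewriting from seeing inside col_base *)
move: FT (mulmx_base C).
move: (col_base C) (row_base C) => F H FT CE.
pose G := F^T *m F.
have GT : G^T = G by rewrite trmx_mul trmxK.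
have Gu : G \in unitmx.
  rewrite -row_free_unit; apply: inj_row_free => w wG0.
  (* w G = 0 gives |w F^T|^2 = w G w^T = 0. *)
  have wF : w *m F^T = 0.
    apply: sqnorm_eq0; rewrite -sqnorm_tr /sqnorm trmxK trmx_mul trmxK.
    by rewrite -mulmxA (mulmxA F^T) -/G mulmxA wG0 mul0mx mxtrace0.
  by apply/eqP; rewrite -(mulmx_free_eq0 w FT) wF.
have GiT : (invmx G)^T = invmx G by rewrite trmx_inv GT.
exists (F *m invmx G *m F^T); split.
- by rewrite !trmx_mul trmxK GiT mulmxA.
- rewrite -!mulmxA (mulmxA F^T F) -/G (mulmxA G) mulmxV // mul1mx.
  by [].
- by rewrite mxtrace_mulC mulmxA -/G mulmxV // mxtrace1.
- have : F *m invmx G *m F^T *m (F *m H) = F *m H.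
    by rewrite mulmxA -(mulmxA _ F^T) -/G mulmxKV.
  by rewrite CE.
Qed.

(** The truncated SVD [A1] is a minimizer, so [rank_proj] does not return its default value.
    Comparing the minimizer U Z^T with [A1] gives the equality case of [svd_proj_approx] for P = U
    U^T. *)
Lemma rank_proj_svd (R : realType) l m r k (A : 'M[R]_(l, m)) U1 U2
    (V1 : 'M[R]_(m, r)) (V2 : 'M[R]_(m, k)) d1 d2
    (U : 'M[R]_(l, r)) (Z : 'M[R]_(m, r)) :
  split_svd A U1 U2 V1 V2 d1 d2 ->
  U^T *m U = 1%:M -> rank_proj r A = U *m Z^T ->
  U *m U^T = U1 *m U1^T /\ Z = A^T *m U.
Proof.
move=> svdA UU projE; set A1 := U1 *m diag_mx d1 *m V1^T.
have AA1 : A - A1 = U2 *m diag_mx d2 *m V2^T.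
  by rewrite (svd_eq svdA) addrC addKr.
have rkA1 : \rank A1 = r.
  apply/eqP; rewrite eqn_leq (leq_trans (mxrankM_maxl _ _)) ?rank_leq_col //=.
  (* The diagonal matrix of [d1] is invertible because d1 > c >= 0, and it factors through [A1],
     whose rank is therefore at least r. *)
  have d1u : diag_mx d1 \in unitmx.
    rewrite unitmxE det_diag unitfE; apply/prodf_neq0 => i _.
    have [c [c0 cd1 _]] := svd_gap svdA.
    by rewrite gt_eqF // (le_lt_trans c0).
  rewrite -{1}(mxrank_unit d1u).
  have -> : diag_mx d1 = U1^T *m A1 *m V1.
    rewrite /A1 !mulmxA (svd_U11 svdA) mul1mx -mulmxA (svd_V11 svdA) mulmx1.
    by [].
  by rewrite (leq_trans (mxrankM_maxl _ _)) // mxrankM_maxr.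
have ex : exists B, [set B | fixed_rank r B /\
    forall C : 'M[R]_(l, m), fixed_rank r C ->
      frobenius_norm (A - B) <= frobenius_norm (A - C)] B.
  exists A1; split=> // C rkC; rewrite frobenius_norm_le AA1.
  (* A competitor of rank r is handled through the projector onto its column space, of trace r. *)
  have [P [PT PP trP PC]] := orthogonal_proj_exists C.
  rewrite rkC in trP.
  by have [] := svd_proj_approx svdA PT PP trP PC.
have [_ /(_ A1 rkA1)] := xgetPex 0 ex.
rewrite -/(rank_proj r A) projE frobenius_norm_le AA1 => le.
have PT : (U *m U^T)^T = U *m U^T by rewrite trmx_mul trmxK.
have PP : U *m U^T *m (U *m U^T) = U *m U^T.
  by rewrite -mulmxA (mulmxA U^T) UU mul1mx.
have trP : \tr (U *m U^T) = r%:R by rewrite mxtrace_mulC UU mxtrace1.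
have PC : U *m U^T *m (U *m Z^T) = U *m Z^T.
  by rewrite -mulmxA (mulmxA U^T) UU mul1mx.
have [_ /(_ le) [PE CE]] := svd_proj_approx svdA PT PP trP PC.
split=> //; apply: trmx_inj; rewrite trmx_mul trmxK.
by rewrite -[LHS]mul1mx -UU -mulmxA CE -mulmxA mulmxA UU mul1mx.
Qed.

(** * From families of singular vectors to matrices of columns *)

Definition colsmx (R : realType) n p (u : 'I_p -> 'cV[R]_n) : 'M[R]_(n, p) :=
  \matrix_(a, i) u i a 0.

Lemma gram_colsmx (R : realType) n p q (u : 'I_p -> 'cV[R]_n)
    (w : 'I_q -> 'cV[R]_n) i j :
  ((colsmx u)^T *m colsmx w) i j = ((u i)^T *m w j) 0 0.
Proof. by rewrite !mxE; apply: eq_bigr => a _; rewrite !mxE. Qed.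

Lemma bilin_colsmx (R : realType) l m p q (u : 'I_p -> 'cV[R]_l)
    (v : 'I_q -> 'cV[R]_m) (A : 'M[R]_(l, m)) i j :
  bilin (u i) A (v j) = ((colsmx u)^T *m A *m colsmx v) i j.
Proof.
rewrite /bilin !mxE; apply: eq_bigr => b _; rewrite !mxE; congr (_ * _).
by apply: eq_bigr => a _; rewrite !mxE.
Qed.

(** The index of the right factor is summed outside, to match the correction terms: i is outermost
    there, and the left factor carries j. *)
Lemma sum_rank1_colsmx (R : realType) l m p q (u : 'I_p -> 'cV[R]_l)
    (v : 'I_q -> 'cV[R]_m) (c : 'M[R]_(p, q)) :
  \sum_(j < q) \sum_(i < p) c i j *: (u i *m (v j)^T) =
  colsmx u *m c *m (colsmx v)^T.
Proof.
apply/matrixP => a b; rewrite summxE !mxE; apply: eq_bigr => j _.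
rewrite summxE !mxE mulr_suml; apply: eq_bigr => i _.
by rewrite !mxE big_ord1 !mxE; ring.
Qed.

Lemma sum_svd_colsmx (R : realType) l m p (u : 'I_p -> 'cV[R]_l)
    (v : 'I_p -> 'cV[R]_m) (s : 'I_p -> R) :
  \sum_(i < p) s i *: (u i *m (v i)^T) =
  colsmx u *m diag_mx (\row_i s i) *m (colsmx v)^T.
Proof.
rewrite -sum_rank1_colsmx; apply: eq_bigr => j _.
rewrite (bigD1 j) //= big1 ?addr0 => [|i ij]; last first.
  by rewrite !mxE (negPf ij) mulr0n scale0r.
by rewrite !mxE eqxx mulr1n.
Qed.

Lemma split_svd_of_is_svd (R : realType) (l m r k : nat) (A : 'M[R]_(l, m))
    (s : 'I_(r + k) -> R) u v :
  (0 < r)%N -> is_svd A s u v -> singular_value s r.+1 < singular_value s r ->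
  split_svd A (colsmx (fun i => u (lshift k i)))
    (colsmx (fun j => u (rshift r j))) (colsmx (fun i => v (lshift k i)))
    (colsmx (fun j => v (rshift r j))) (\row_i s (lshift k i))
    (\row_j s (rshift r j)).
Proof.
move=> r0 [ou ov s0 smono Aeq] gap.
have gramE n (w : 'I_(r + k) -> 'cV[R]_n) p q (f : 'I_p -> _) (g : 'I_q -> _) :
    orthonormal_family w -> forall i j,
    ((colsmx (fun i => w (f i)))^T *m colsmx (fun j => w (g j))) i j =
    (f i == g j)%:R.
  by move=> ow i j; rewrite gram_colsmx ow mxE eqxx mulr1n.
have lr0 n (w : 'I_(r + k) -> 'cV[R]_n) : orthonormal_family w ->
    (colsmx (fun i => w (lshift k i)))^T *m colsmx (fun j => w (rshift r j)) = 0.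
  by move=> ow; apply/matrixP => i j; rewrite gramE // eq_lrshift mxE.
have ll1 n (w : 'I_(r + k) -> 'cV[R]_n) : orthonormal_family w ->
    (colsmx (fun i => w (lshift k i)))^T *m colsmx (fun j => w (lshift k j)) =
    1%:M.
  by move=> ow; apply/matrixP => i j; rewrite gramE // eq_lshift mxE.
have rr1 n (w : 'I_(r + k) -> 'cV[R]_n) : orthonormal_family w ->
    (colsmx (fun i => w (rshift r i)))^T *m colsmx (fun j => w (rshift r j)) =
    1%:M.
  by move=> ow; apply/matrixP => i j; rewrite gramE // eq_rshift mxE.
split; [exact: ll1|exact: rr1|exact: lr0|exact: ll1|exact: rr1|exact: lr0| |].
  by rewrite Aeq big_split_ord /= !sum_svd_colsmx.
exists (singular_value s r.+1); split.
- by rewrite /singular_value /=; case: insub => /=.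
(* i < r means i <= r - 1, the 0-based position of sigma_r; this is where 0 < r enters. *)
- move=> i; rewrite mxE; apply: lt_le_trans gap _; rewrite /singular_value.
  case: insubP => [j _ je|] /=; last by rewrite s0.
  by apply: smono; rewrite je /= -ltnS prednK.
- move=> j; rewrite mxE s0 /= /singular_value /=.
  case: insubP => [i _ ie|] /=; first by apply: smono; rewrite ie leq_addr.
  (* Position r is out of range only if k = 0, and then there is no j. *)
  rewrite -leqNgt addnC -{2}[r]add0n leq_add2r leqn0 => /eqP k0.
  by have := ltn_ord j; rewrite [X in (_ < X)%N]k0.
Qed.

(** * Derivatives of matrix-valued curves *)

Lemma is_derive_mxP (R : realType) (m n : nat) (A : R -> 'M[R]_(m, n)) (t : R) dA :
  is_derive t 1 A dA <-> forall i j, is_derive t 1 (fun x => A x i j) (dA i j).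
Proof.
split=> [[Ad <-] i j|Aij].
  have Ad' := (derivable_mxP A t 1).1 Ad i j.
  by split=> //; rewrite derive_mx // mxE.
have Ad : derivable A t 1.
  by apply/derivable_mxP => i j; have [] := Aij i j.
split=> //; rewrite derive_mx //; apply/matrixP => i j; rewrite mxE.
by have [_] := Aij i j.
Qed.

Lemma is_derive_mulmx (R : realType) (m n p : nat) (A : R -> 'M[R]_(m, n))
    (B : R -> 'M[R]_(n, p)) (t : R) dA dB :
  is_derive t 1 A dA -> is_derive t 1 B dB ->
  is_derive t 1 (fun x => A x *m B x) (dA *m B t + A t *m dB).
Proof.
move=> /is_derive_mxP Ad /is_derive_mxP Bd; apply/is_derive_mxP => i j.
have -> : (fun x => (A x *m B x) i j) =
    \sum_(h < n) ((fun x => A x i h) * (fun x => B x h j)).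
  by apply/funext => x; rewrite mxE fct_sumE.
have dsum : is_derive t 1
    (\sum_(h < n) ((fun x => A x i h) * (fun x => B x h j)))
    (\sum_(h < n) (A t i h *: dB h j + B t h j *: dA i h)).
  by apply: is_derive_sum => h; apply: is_deriveM.
apply: is_derive_eq dsum _.
rewrite !mxE -big_split; apply: eq_bigr => h _ /=.
by rewrite /GRing.scale /= addrC [B t h j * _]mulrC.
Qed.

Lemma is_derive_trmx (R : realType) (m n : nat) (A : R -> 'M[R]_(m, n)) (t : R) dA :
  is_derive t 1 A dA -> is_derive t 1 (fun x => (A x)^T) dA^T.
Proof.
move=> /is_derive_mxP Ad; apply/is_derive_mxP => i j; rewrite mxE.
by have -> : (fun x => (A x)^T i j) = (fun x => A x j i)
  by apply/funext => x; rewrite mxE.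
Qed.

Lemma is_derive_unique (R : realType) (W : normedModType R) (f : R -> W) (t : R) d d' :
  is_derive t 1 f d -> is_derive t 1 f d' -> d = d'.
Proof. by move=> [_ <-] [_ <-]. Qed.

(** * Algebra of the evolution equations at a fixed time *)

(** U Z^T is the leading part of A, and the trailing part annihilates Z because V2^T Z = 0.
    Differentiating this relation is what determines the derivative of U. *)
Lemma svd_modes_commute (R : realType) l m r k (A : 'M[R]_(l, m)) U1 U2
    (V1 : 'M[R]_(m, r)) (V2 : 'M[R]_(m, k)) d1 d2
    (U : 'M[R]_(l, r)) (Z : 'M[R]_(m, r)) :
  split_svd A U1 U2 V1 V2 d1 d2 ->
  U^T *m U = 1%:M -> U *m U^T = U1 *m U1^T -> Z = A^T *m U ->
  A *m Z = U *m (Z^T *m Z).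
Proof.
move=> [U11 _ U12 V11 V22 V12 Aeq _] UU PE ZE.
have U21 := trmx_mul0 U12; have V21 := trmx_mul0 V12.
have U2U : U2^T *m U = 0.
  by rewrite -[U]mulmx1 -UU (mulmxA U) PE !mulmxA U21 !mul0mx.
have V2Z : V2^T *m Z = 0.
  rewrite ZE Aeq linearD /= !trmx_mul !trmxK mulmxDl mulmxDr !mulmxA V21 !mul0mx.
  by rewrite add0r V22 mul1mx -mulmxA U2U mulmx0.
have UZ : U *m Z^T = U1 *m diag_mx d1 *m V1^T.
  rewrite ZE trmx_mul trmxK mulmxA PE Aeq mulmxDr !mulmxA -(mulmxA _ U1^T U1).
  by rewrite -(mulmxA _ U1^T U2) U11 U12 mulmx1 mulmx0 !mul0mx addr0.
by rewrite mulmxA UZ Aeq mulmxDl -(mulmxA _ V2^T) V2Z mulmx0 addr0.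
Qed.

(** The derivatives enter only as matrices satisfying the differentiated relations. B stands for the
    derivative of Z^T Z, which the projection removes. *)
Lemma dyn_orth_equations (R : realType) l m r k (A dA : 'M[R]_(l, m)) U1 U2
    (V1 : 'M[R]_(m, r)) (V2 : 'M[R]_(m, k)) d1 d2
    (U dU : 'M[R]_(l, r)) (Z dZ : 'M[R]_(m, r)) (B : 'M[R]_r) :
  split_svd A U1 U2 V1 V2 d1 d2 ->
  U^T *m U = 1%:M -> U *m U^T = U1 *m U1^T -> Z = A^T *m U ->
  U^T *m dU = 0 -> dZ = dA^T *m U + A^T *m dU ->
  dA *m Z + A *m dZ = dU *m (Z^T *m Z) + U *m B ->
  let a := U2^T *m dA *m V1 in
  let b := U1^T *m dA *m V2 in
  dU = (1%:M - U *m U^T) *m dA *m Z *m invmx (Z^T *m Z)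
    + U2 *m (\matrix_(j, i) (d2 0 j / (d1 0 i ^+ 2 - d2 0 j ^+ 2)
                 * (d2 0 j * a j i + d1 0 i * b i j))) *m V1^T
       *m Z *m invmx (Z^T *m Z)
  /\ dZ = dA^T *m U
    + V2 *m (\matrix_(j, i) (d2 0 j / (d1 0 i ^+ 2 - d2 0 j ^+ 2)
                 * (d1 0 i * a j i + d2 0 j * b i j))) *m U1^T *m U.
Proof.
move=> [U11 U22 U12 V11 V22 V12 Aeq [c [c0 cd1 cd2]]] UU PE ZE UdU dZE eq a b.
have U21 := trmx_mul0 U12;
have AT : A^T = V1 *m diag_mx d1 *m U1^T + V2 *m diag_mx d2 *m U2^T.
  by rewrite Aeq linearD /= !trmx_mul !trmxK !tr_diag_mx !mulmxA.
(* Q is the orthogonal change of basis from the singular vectors U1 to the modes U of the same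
   subspace. *)
have [Q QE] : exists Q, U1^T *m U = Q by exists (U1^T *m U).
have [N NE] : exists N, 1%:M - U *m U^T = N by exists (1%:M - U *m U^T).
have QQT : Q *m Q^T = 1%:M.
  by rewrite -QE trmx_mul trmxK mulmxA -(mulmxA _ U) PE mulmxA U11 mul1mx.
have QTQ : Q^T *m Q = 1%:M by exact: mulmx1C.
have UE : U = U1 *m Q by rewrite -QE mulmxA -PE -mulmxA UU mulmx1.
have U2U : U2^T *m U = 0 by rewrite UE mulmxA U21 mul0mx.
have U1dU : U1^T *m dU = 0.
  by rewrite -[U1^T]mul1mx -U11 -(mulmxA _ U1) -PE -!mulmxA UdU !mulmx0.
have ZQ : Z = V1 *m diag_mx d1 *m Q.
  by rewrite ZE AT mulmxDl -!(mulmxA _ _ U) U2U mulmx0 addr0 QE.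
have ZZ : Z^T *m Z = Q^T *m (diag_mx d1 *m diag_mx d1) *m Q.
  by rewrite ZQ !trmx_mul tr_diag_mx !mulmxA -(mulmxA _ V1^T) V11 mulmx1.
have d1gt0 i : 0 < d1 0 i by exact: le_lt_trans (cd1 i).
have ZZu : Z^T *m Z \in unitmx.
  have d1u : diag_mx d1 \in unitmx.
    by rewrite unitmxE det_diag unitfE; apply/prodf_neq0 => i _; rewrite gt_eqF.
  have [Ou _] := mulmx1_unit QQT.
  by rewrite ZZ !unitmx_mul unitmx_tr Ou d1u.
have NU : N *m U = 0 by rewrite -NE mulmxBl mul1mx -mulmxA UU mulmx1 subrr.
have NdU : N *m dU = dU by rewrite -NE mulmxBl mul1mx -mulmxA UdU mulmx0 subr0.
have U2N : U2^T *m N = U2^T.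
  by rewrite -NE mulmxBr mulmx1 mulmxA U2U mul0mx subr0.
have NA : N *m A = U2 *m diag_mx d2 *m V2^T.
  have NU1 : N *m U1 = 0.
    by rewrite -NE PE mulmxBl mul1mx -mulmxA U11 mulmx1 subrr.
  have NU2 : N *m U2 = U2.
    by rewrite -NE PE mulmxBl mul1mx -mulmxA U12 mulmx0 subr0.
  by rewrite Aeq mulmxDr !mulmxA NU1 NU2 !mul0mx add0r.
have aE : U2^T *m dA *m V1 = a by [].
have bE : b^T = V2^T *m dA^T *m U1 by rewrite !trmx_mul trmxK mulmxA.
clearbody a b.
(* E = U2^T U' Q^T is the unknown: the off-diagonal block, in the singular basis, of the derivative
   of U U^T. *)
have [E EQ] : exists E, U2^T *m dU = E *m Q.
  by exists (U2^T *m dU *m Q^T); rewrite -mulmxA QTQ mulmx1.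
have AdU : A^T *m dU = V2 *m diag_mx d2 *m E *m Q.
  rewrite AT mulmxDl -(mulmxA _ U1^T) U1dU mulmx0 add0r -(mulmxA _ U2^T) EQ.
  by rewrite !mulmxA.
have NAdZ : N *m A *m dZ = U2 *m diag_mx d2 *m (b^T + diag_mx d2 *m E) *m Q.
  rewrite NA dZE AdU {1}UE [in LHS]mulmxDr [in RHS]mulmxDr [in RHS]mulmxDl bE.
  congr (_ + _); first by rewrite !mulmxA.
  by rewrite !mulmxA -(mulmxA _ V2^T V2) V22 mulmx1.
(* N U = 0 eliminates B, and N U' = U' is the gauge condition. *)
have Neq : dU *m (Z^T *m Z) = N *m dA *m Z + N *m A *m dZ.
  have := congr1 (mulmx N) eq.
  by rewrite !mulmxDr !mulmxA NU NdU mul0mx addr0 => ->.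
(* The Sylvester equation: [Neq] multiplied by U2^T on the left and by Q^T on the right. *)
have eqE : E *m (diag_mx d1 *m diag_mx d1) =
    a *m diag_mx d1 + diag_mx d2 *m b^T + diag_mx d2 *m (diag_mx d2 *m E).
  have QQTK p (M : 'M[R]_(p, r)) : M *m Q *m Q^T = M by rewrite -mulmxA QQT mulmx1.
  have := congr1 (fun M => U2^T *m M *m Q^T) Neq.
  rewrite /= NAdZ ZZ ZQ !(mulmxDr, mulmxDl) !mulmxA U2N EQ U22 aE mul1mx !QQTK.
  by move=> ->; rewrite addrA.
have gt2 i j : d1 0 i ^+ 2 - d2 0 j ^+ 2 != 0.
  have /andP[d20 d2c] := cd2 j.
  rewrite gt_eqF // subr_gt0 ltrXn2r ?nnegrE ?(ltW (d1gt0 i)) //.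
  exact: le_lt_trans d2c (cd1 i).
have Eji j i : E j i = (d1 0 i * a j i + d2 0 j * b i j) /
                       (d1 0 i ^+ 2 - d2 0 j ^+ 2).
  have := congr1 (fun M => fun_of_matrix M j i) eqE.
  rewrite mulmx_diag mulmxA mulmx_diag mul_mx_diag.
  rewrite !(mul_mx_diag, mul_diag_mx) !mxE => h.
  apply: (mulIf (gt2 i j)); rewrite divfK // mulrBr.
  have -> : E j i * d1 0 i ^+ 2 = E j i * (d1 0 i * d1 0 i) by rewrite expr2.
  by rewrite h; ring.
(* The correction to Z' is A^T U' = V2 D2 E Q, so its coefficient is that of E times sigma_{r+j}. *)
split; last first.
  rewrite dZE AdU; congr (_ + _); rewrite -[RHS]mulmxA QE; congr (_ *m _).
  rewrite -mulmxA; congr (_ *m _); apply/matrixP => j i.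
  by rewrite mul_diag_mx !mxE Eji; ring.
have dUE : dU = dU *m (Z^T *m Z) *m invmx (Z^T *m Z) by rewrite mulmxK.
rewrite {1}dUE Neq -mulmxDl; congr (_ *m _); rewrite NE; congr (_ + _).
(* V1^T Z = D1 Q supplies a factor sigma_i on the side of the formula; the entries then agree
   because b + d2 E = d1 (d2 a + d1 b) / (d1^2 - d2^2). *)
rewrite NAdZ ZQ !mulmxA -(mulmxA _ V1^T) V11 mulmx1; congr (_ *m _).
rewrite -!mulmxA; congr (_ *m _); apply/matrixP => j i.
rewrite !mul_diag_mx mul_mx_diag !mxE Eji.
by field; exact: gt2.
Qed.

(** * Evolution of modes and coefficients along the curve *)

Theorem mainTheorem4 (R : realType) (l m r k : nat)
  (hr : (0 < r)%N) (hrk : (r + k)%N = minn l m)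
  (D : set R) (hD : open D)
  (L : R -> 'M[R]_(l, m) -> 'M[R]_(l, m))
  (X : R -> 'M[R]_(l, m))
  (hX : forall t : R, D t -> is_derive t 1 X (L t (X t)))
  (s : R -> 'I_(r + k) -> R)
  (u : R -> 'I_(r + k) -> 'cV[R]_l)
  (v : R -> 'I_(r + k) -> 'cV[R]_m)
  (hsvd : forall t : R, D t -> is_svd (X t) (s t) (u t) (v t))
  (hgap : forall t : R, D t ->
     singular_value (s t) r > singular_value (s t) r.+1)
  (U : R -> 'M[R]_(l, r)) (Z : R -> 'M[R]_(m, r))
  (hUZ : forall t : R, D t -> rank_proj r (X t) = U t *m (Z t)^T)
  (hU : forall t : R, D t -> (U t)^T *m U t = 1%:M)
  (hdU : forall t : R, D t -> derivable U t 1)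
  (hgauge : forall t : R, D t -> (U t)^T *m 'D_1 U t = 0) :
  forall t : R, D t ->
    let dX := 'D_1 X t in
    let sI := fun i : 'I_r => s t (lshift k i) in
    let uI := fun i : 'I_r => u t (lshift k i) in
    let vI := fun i : 'I_r => v t (lshift k i) in
    let sJ := fun j : 'I_k => s t (rshift r j) in
    let uJ := fun j : 'I_k => u t (rshift r j) in
    let vJ := fun j : 'I_k => v t (rshift r j) in
    is_derive t 1 U
      ((1%:M - U t *m (U t)^T) *m dX *m Z t *m invmx ((Z t)^T *m Z t)
       + (\sum_(i < r) \sum_(j < k)
            (sJ j / (sI i ^+ 2 - sJ j ^+ 2)
             * (sJ j * bilin (uJ j) dX (vI i) + sI i * bilin (uI i) dX (vJ j)))
            *: (uJ j *m (vI i)^T))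
         *m Z t *m invmx ((Z t)^T *m Z t))
    /\
    is_derive t 1 Z
      (dX^T *m U t
       + (\sum_(i < r) \sum_(j < k)
            (sJ j / (sI i ^+ 2 - sJ j ^+ 2)
             * (sI i * bilin (uJ j) dX (vI i) + sJ j * bilin (uI i) dX (vJ j)))
            *: (vJ j *m (uI i)^T))
         *m U t).
Proof.
move=> t Dt dX sI uI vI sJ uJ vJ.
have svdX x (Dx : D x) := split_svd_of_is_svd hr (hsvd x Dx) (hgap x Dx).
have proj x (Dx : D x) := rank_proj_svd (svdX x Dx) (hU x Dx) (hUZ x Dx).
have PE x (Dx : D x) := (proj x Dx).1.
have ZE x (Dx : D x) := (proj x Dx).2.
have nearD : \near t, D t by exact: open_nbhs_nbhs.
have dXt : is_derive t 1 X dX by apply: derivableP; have [] := hX t Dt.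
have dUt : is_derive t 1 U ('D_1 U t) := derivableP (hdU t Dt).
(* Z = X^T U holds on a neighbourhood of t, D being open, so the product rule makes Z
   differentiable. *)
have dZt : is_derive t 1 Z (dX^T *m U t + (X t)^T *m 'D_1 U t).
  apply: near_eq_is_derive (is_derive_mulmx (is_derive_trmx dXt) dUt).
  by near=> x; rewrite -ZE //; near: x.
have XZ x (Dx : D x) : X x *m Z x = U x *m ((Z x)^T *m Z x).
  exact: svd_modes_commute (svdX x Dx) (hU x Dx) (PE x Dx) (ZE x Dx).
(* Both sides of [XZ] are differentiated at t; their agreement near t is the remaining premise. *)
have eq := is_derive_unique (is_derive_mulmx dXt dZt) (near_eq_is_derive _
  (is_derive_mulmx dUt (is_derive_mulmx (is_derive_trmx dZt) dZt))).
have [] := dyn_orth_equations (svdX t Dt) (hU t Dt) (PE t Dt) (ZE t Dt)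
  (hgauge t Dt) erefl (eq _).
  by near=> x; rewrite XZ //; near: x.
have sIE i : (\row_i s t (lshift k i)) 0 i = sI i by rewrite mxE.
have sJE j : (\row_j s t (rshift r j)) 0 j = sJ j by rewrite mxE.
move=> dUE dZE; split.
  apply: is_derive_eq dUt _; rewrite [LHS]dUE; congr (_ + _).
  congr (_ *m _ *m _); rewrite -sum_rank1_colsmx.
  apply: eq_bigr => i _; apply: eq_bigr => j _.
  by rewrite mxE sIE sJE !bilin_colsmx.
apply: is_derive_eq dZt _; rewrite [LHS]dZE; congr (_ + _).
congr (_ *m _); rewrite -sum_rank1_colsmx.
apply: eq_bigr => i _; apply: eq_bigr => j _.
by rewrite mxE sIE sJE !bilin_colsmx.
Unshelve. all: by end_near. Qed.
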